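(* Let $k\ge 2$ be an integer and suppose that $C\subseteq\mathbb{Z}$ arises as a minimal additive complement (in $\mathbb{Z}$) to a set $W\subseteq \mathbb{Z}$ of size $k$. Then $$\frac{1}{k} \leq \underline{b}(C) \leq \overline{b}(C) \leq \frac{k}{2k - 1}.$$
   Context: For $C,W\subseteq\mathbb{Z}$, $C+W=\{c+w: c\in C, w\in W\}$. $C$ is a minimal additive complement to $W$ if $C+W=\mathbb{Z}$ and $C'+W\ne\mathbb{Z}$ for every proper subset $C'\subsetneq C$. The upper and lower Banach densities of $C\subseteq\mathbb{Z}$ are $$\overline{b}(C) = \lim_{n \to \infty} \max_{x \in \mathbb{Z}} \frac{|C \cap [x+1, x+n]|}{n},\qquad \underline{b}(C) = \lim_{n \to \infty} \min_{x \in \mathbb{Z}} \frac{|C \cap [x+1, x+n]|}{n},$$ where $[x+1,x+n]$ is the integer interval; these limits always exist. *)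

(* Defs.v *)
From mathcomp Require Import all_boot all_order all_algebra finmap.
From mathcomp Require Import all_classical all_reals all_analysis.
Import Order.TTheory GRing.Theory Num.Theory.
Import numFieldNormedType.Exports.

Set Implicit Arguments.
Unset Strict Implicit.
Unset Printing Implicit Defensive.

Local Open Scope classical_set_scope.
Local Open Scope ring_scope.

Definition sumset (C W : set int) : set int := [set c + w | c in C & w in W].

Definition minimal_additive_complement (C W : set int) : Prop :=
  sumset C W = setT /\ forall C', C' `<` C -> sumset C' W <> setT.

Definition window_count (C : set int) (x : int) (n : nat) : nat :=
  #|` fset_set (C `&` [set y : int | x + 1 <= y <= x + n%:Z])|.

Definition window_density (R : realType) (C : set int) (n : nat) (x : int) : R :=
  (window_count C x n)%:R / n%:R.

(* For fixed n the densities lie in the finite set {0/n, ..., n/n}, so the sup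
   and inf over x are attained: they are the max and the min. The term n = 0
   (where division by zero yields 0) does not affect the limits, which exist for
   every C, by sub- and superadditivity of the extremal counts in n. *)
Definition upper_banach_density (R : realType) (C : set int) : R :=
  limn (fun n => sup (range (window_density R C n))).

Definition lower_banach_density (R : realType) (C : set int) : R :=
  limn (fun n => inf (range (window_density R C n))).

(* Main.v *)
Require Import Defs.
From mathcomp Require Import all_boot all_order all_algebra finmap.
From mathcomp Require Import all_classical all_reals all_analysis.
From mathcomp Require Import zify lra.
Import Order.TTheory GRing.Theory Num.Theory.
Import numFieldNormedType.Exports.

Local Open Scope classical_set_scope.
Local Open Scope ring_scope.

(** If every element of [W] has absolute value at most [D], then [C + W = Z]
    shows that a window of length [n] contains at least [(n - 2D) / k] points of
    [C]. Conversely, minimality gives each [c] in [C] an integer [u c] in [c + W]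
    whose only representation as a sum uses [c]. For the set [A] of the points of
    [C] in a window of length [n], the [k |A|] sums [a + w] lie in an interval [E]
    of length [n + 2D]; the [|A|] values of [u] are represented once and the other
    points of [E] at most [k] times, so [k |A| <= |A| + k (n + 2D - |A|)]. The
    limits defining the densities exist by Fekete's lemma. *)

(** * Counting sums in an abelian group, and uniquely represented sums *)

Lemma unique_sum_card_le (V : zmodType) (u : V -> V) (A W E : seq V) :
  uniq A -> uniq W -> uniq E ->
  (forall a w, a \in A -> w \in W -> a + w \in E) ->
  (forall a, a \in A -> u a - a \in W) ->
  (forall a b w, a \in A -> b \in A -> w \in W -> b + w = u a -> b = a) ->
  (size A * size W <= size A + (size E - size A) * size W)%N.
Proof.
move=> uA uW uE AWE uAW u_uniq.
(* A pair [(a, w)] is encoded as [(a + w, w)]: these codes lie in the list [t]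
   of the codes of the unique sums [u a] and of all pairs in [(E \ U) x W]. *)
pose s := [seq (a + w, w) | a <- A, w <- W].
pose U := [seq u a | a <- A].
pose t := [seq (u a, u a - a) | a <- A] ++
          [seq (z, w) | z <- [seq z <- E | z \notin U], w <- W].
have u_in a : a \in A -> u a \in E.
  by move=> aA; rewrite -[u a](subrKC a) AWE ?uAW.
have u_inj : {in A &, injective u}.
  move=> a b aA bA uab; apply/esym/(u_uniq a b (u b - b)) => //; first exact: uAW.
  by rewrite subrKC uab.
have us : uniq s.
  apply: allpairs_uniq => // -[a w] [b v] _ _ /= [+ wv].
  by rewrite wv => /addIr ->.
have st : {subset s <= t}.
  move=> _ /allpairsP[[a w] /= [aA wW ->]]; rewrite mem_cat.
  have [/mapP[b bA awb]|awU] := boolP (a + w \in U).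
    (* A sum equal to [u b] must use [b], so [w] is [u a - a] and the code falls in the first half
       of [t]. *)
    have ab := u_uniq _ _ _ bA aA wW awb; rewrite -{}ab in awb.
    by apply/orP; left; apply/mapP; exists a; rewrite // -awb [a + w]addrC addrK.
  apply/orP; right; apply/allpairsP; exists (a + w, w) => /=; split=> //.
  by rewrite mem_filter awU AWE.
have := uniq_leq_size us st.
rewrite size_cat !size_allpairs size_map.
have -> : size [seq z <- E | z \notin U] = (size E - size A)%N.
  (* As [u] is injective on [A], the unique sums fill exactly [size A] places of [E]. *)
  have EU : perm_eq [seq z <- E | z \in U] U.
    apply: uniq_perm; rewrite ?filter_uniq // ?map_inj_in_uniq // => z.
    rewrite mem_filter andb_idr // => /mapP[a aA ->]; exact: u_in.
  have := perm_size EU; rewrite size_map => <-.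
  by rewrite -(count_predC (mem U) E) !size_filter addKn.
by [].
Qed.

Lemma sum_cover_card_le (V : zmodType) (A W E : seq V) :
  uniq E -> (forall z, z \in E -> exists2 a, a \in A & z - a \in W) ->
  (size E <= size A * size W)%N.
Proof.
move=> uE cov; rewrite -(size_allpairs +%R); apply: uniq_leq_size => // z /cov[a aA zaW].
by apply/allpairsP; exists (a, z - a); rewrite /= subrKC.
Qed.

(** Removing [c] from [C] leaves some integer uncovered; every representation of that integer then
    uses [c], and one exists since [C + W] is everything. *)
Lemma minimal_complement_unique_sum (C W : set int) :
  minimal_additive_complement C W ->
  exists u : int -> int, forall c, C c -> W (u c - c) /\
    forall a w, C a -> W w -> a + w = u c -> a = c.
Proof.
move=> [CW Cmin].
suff /choice[u uP] : forall c, exists z, C c -> W (z - c) /\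
    forall a w, C a -> W w -> a + w = z -> a = c by exists u.
move=> c; have [Cc|] := pselect (C c); last by exists 0.
have CcC : C `\ c `<` C.
  by split=> [a []//|/(_ c Cc)[_]]; apply.
have /existsNP[z zP] : ~ forall z, sumset (C `\ c) W z.
  by move=> all_z; apply: (Cmin _ CcC); apply/seteqP; split.
have z_uniq a w : C a -> W w -> a + w = z -> a = c.
  by move=> Ca Ww awz; apply: contra_notP zP => ac; exists a => //; exists w.
exists z => _; split => //.
have [a Ca [w Ww awz]] : sumset C W z by rewrite CW.
by rewrite -(z_uniq a w) // -awz [a + w]addrC addrK.
Qed.

(** * Limits and Fekete's lemma *)

Lemma near_infty_div_le (R : realType) (K e : R) :
  0 < e -> \forall n \near \oo, K / n%:R <= e.
Proof.
move=> e_gt0; exists (Num.bound `|K / e|).+1 => //= n /= len.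
have n_gt0 : 0 < n%:R :> R by rewrite ltr0n; lia.
rewrite ler_pdivrMr // mulrC -ler_pdivrMr //.
rewrite (le_trans (ler_norm _)) // (le_trans (ltW (archi_boundP (normr_ge0 _)))) //.
by rewrite ler_nat ltnW.
Qed.

(* Fekete's lemma for the subadditive sequence [n * d n], whose value at [n = 0]
   is [0] whatever [d 0] is. *)
Lemma fekete_cvg (R : realType) (d : R^nat) (B : R) :
  (forall n, B <= d n) ->
  (forall m n, (m + n)%:R * d (m + n)%N <= m%:R * d m + n%:R * d n) ->
  cvgn d.
Proof.
move=> d_ge dD.
have dM m q : (q * m)%:R * d (q * m)%N <= (q * m)%:R * d m.
  elim: q => [|q IH]; first by rewrite mul0n !mul0r.
  by rewrite mulSn (le_trans (dD _ _)) // natrD mulrDl lerD2l.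
(* The limit is the infimum over positive indices only, as [d 0] is arbitrary. *)
pose E := [set d n.+1 | n in setT]; pose L := inf E.
have E_lb : has_lbound E by exists B => _ [n _ <-].
apply/cvg_ex; exists L; apply/cvgrPdist_le => e e_gt0.
have [|_ [m' _ <-]] := @inf_adherent R E (e / 2) ltac:(lra).
  by split => //; exists (d 1%N), 0%N.
rewrite -/L; set m := m'.+1 => dm_lt.
(* With [n = q * m + r] and [r < m], the block [q * m] costs at most [d m] per unit and the
   remainder at most [d 1]; the excess [r * (d 1 - d m)] is at most [K]. *)
pose K := m%:R * `|d 1%N - d m|.
near=> n.
have n_gt0 : (0 < n)%N by near: n; exact: nbhs_infty_gt.
have nR_gt0 : 0 < n%:R :> R by rewrite ltr0n.
have L_le : L <= d n by apply: ge_inf => //; exists n.-1; rewrite ?prednK.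
have dn_le : d n <= d m + K / n%:R.
  rewrite -(ler_pM2l nR_gt0) mulrDr [_ * (K / _)]mulrC mulfVK ?gt_eqF //.
  have En := divn_eq n m; have r_lt : (n %% m < m)%N by rewrite ltn_mod.
  rewrite {1 2}En.
  apply: le_trans (dD _ _) _.
  have := lerD (dM m (n %/ m)%N) (dM 1%N (n %% m)%N); rewrite muln1 => /le_trans; apply.
  have -> : n%:R = (n %/ m * m)%:R + (n %% m)%:R :> R by rewrite -natrD -En.
  rewrite mulrDl -addrA lerD2l -lerBlDl -mulrBr.
  apply: le_trans (ler_norm _) _; rewrite normrM ger0_norm ?ler0n //.
  by rewrite ler_wpM2r // ler_nat ltnW.
have : K / n%:R <= e / 2 by near: n; apply: near_infty_div_le; lra.
by rewrite ler_norml; lra.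
Unshelve. all: by end_near. Qed.

(** * Integer windows as lists *)

Definition zwindow (x : int) (n : nat) : seq int :=
  [seq x + i.+1%:Z | i <- iota 0 n].

Lemma size_zwindow x n : size (zwindow x n) = n.
Proof. by rewrite size_map size_iota. Qed.

Lemma zwindow_uniq x n : uniq (zwindow x n).
Proof. by rewrite map_inj_uniq ?iota_uniq // => i j; lia. Qed.

Lemma mem_zwindow x n y : (y \in zwindow x n) = (x + 1 <= y <= x + n%:Z).
Proof.
apply/mapP/idP => [[i + ->]|xyn]; first by rewrite mem_iota; lia.
by exists (absz (y - x - 1)%R); rewrite ?mem_iota; lia.
Qed.

Lemma zwindow_cat x m n : zwindow x (m + n) = zwindow x m ++ zwindow (x + m%:Z) n.
Proof.
rewrite /zwindow iotaD map_cat add0n -{2}[m]addn0 iotaDl -map_comp.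
by congr (_ ++ _); apply: eq_map => i /=; lia.
Qed.

Lemma window_countE (C : set int) x n :
  window_count C x n = size [seq y <- zwindow x n | y \in C].
Proof.
have Esub : C `&` [set y : int | x + 1 <= y <= x + n%:Z]
          = [set y | y \in [fset y in zwindow x n | y \in C]%fset].
  apply/seteqP; split=> y /=; rewrite !inE /= mem_zwindow.
    by case=> Cy ->; rewrite mem_set.
  by case/andP=> -> /set_mem.
by rewrite /window_count Esub set_fsetK card_imfset //= undup_id ?zwindow_uniq.
Qed.

Lemma window_countD (C : set int) x m n :
  window_count C x (m + n) =
  (window_count C x m + window_count C (x + m%:Z) n)%N.
Proof. by rewrite !window_countE zwindow_cat filter_cat size_cat. Qed.

Lemma window_count_le (C : set int) x n : (window_count C x n <= n)%N.
Proof.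
by rewrite window_countE size_filter (leq_trans (count_size _ _)) ?size_zwindow.
Qed.

(** * Existence and estimation of Banach densities *)

Section Density.
Variables (R : realType) (C : set int).

Local Notation density := (window_density R C).

Lemma window_density_itv n x : 0 <= density n x <= 1.
Proof.
rewrite divr_ge0 //=; case: n => [|n]; first by rewrite /window_density invr0 mulr0 ler01.
by rewrite ler_pdivrMr ?ltr0n // mul1r ler_nat window_count_le.
Qed.

Lemma mul_window_density n x : n%:R * density n x = (window_count C x n)%:R.
Proof.
case: n => [|n]; last by rewrite mulrC divfK ?pnatr_eq0.
have := window_count_le C x 0; rewrite leqn0 => /eqP ->.
by rewrite mul0r.
Qed.

Lemma window_density_ubound n : has_ubound (range (density n)).
Proof. by exists 1 => _ [x _ <-]; case/andP: (window_density_itv n x). Qed.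

Lemma window_density_lbound n : has_lbound (range (density n)).
Proof. by exists 0 => _ [x _ <-]; case/andP: (window_density_itv n x). Qed.

Lemma window_density_nonempty n : range (density n) !=set0.
Proof. by exists (density n 0), 0. Qed.

Lemma window_density_le_sup n x : density n x <= sup (range (density n)).
Proof. by apply: ub_le_sup; [exact: window_density_ubound|exists x]. Qed.

Lemma inf_le_window_density n x : inf (range (density n)) <= density n x.
Proof. by apply: ge_inf; [exact: window_density_lbound|exists x]. Qed.

Lemma mul_window_densityD m n x :
  (m + n)%:R * density (m + n) x =
  m%:R * density m x + n%:R * density n (x + m%:Z).
Proof. by rewrite !mul_window_density window_countD natrD. Qed.

(** Counts over adjacent windows add up, so [n] times the supremum is subadditive and Fekete's lemma
    applies. *)
Lemma sup_window_density_cvg : cvgn (fun n => sup (range (density n))).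
Proof.
have d_ge0 n : 0 <= sup (range (density n)).
  apply: le_trans (window_density_le_sup n 0).
  by case/andP: (window_density_itv n 0).
apply: (@fekete_cvg _ _ 0) => [//|m n].
have [->|mn_gt0] := posnP (m + n); first by rewrite mul0r addr_ge0 ?mulr_ge0.
rewrite mulrC -ler_pdivlMr ?ltr0n //.
apply: ge_sup; first exact: window_density_nonempty.
move=> _ [x _ <-]; rewrite ler_pdivlMr ?ltr0n // mulrC mul_window_densityD.
by rewrite lerD // ler_wpM2l // window_density_le_sup.
Qed.

(** Here [n] times the infimum is superadditive, so Fekete's lemma is applied to its negation,
    bounded below by [-1]. *)
Lemma inf_window_density_cvg : cvgn (fun n => inf (range (density n))).
Proof.
suff : cvgn (fun n => - inf (range (density n))).
  by move=> ?; rewrite -(is_cvgNE (fun n => inf (range (density n)))).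
apply: (@fekete_cvg _ _ (- 1)) => [n|m n].
  rewrite lerN2; apply: le_trans (inf_le_window_density n 0) _.
  by case/andP: (window_density_itv n 0).
suff infD : m%:R * inf (range (density m)) + n%:R * inf (range (density n))
    <= (m + n)%:R * inf (range (density (m + n))).
  by lra.
have [mn0|mn_gt0] := posnP (m + n).
  by move/eqP: mn0; rewrite addn_eq0 => /andP[/eqP -> /eqP ->]; rewrite !mul0r addr0.
rewrite [leRHS]mulrC -ler_pdivrMr ?ltr0n //.
apply: lb_le_inf; first exact: window_density_nonempty.
move=> _ [x _ <-]; rewrite ler_pdivrMr ?ltr0n // [leRHS]mulrC mul_window_densityD.
by rewrite lerD // ler_wpM2l // inf_le_window_density.
Qed.

Lemma lower_le_upper_banach_density :
  lower_banach_density R C <= upper_banach_density R C.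
Proof.
apply: ler_lim; [exact: inf_window_density_cvg|exact: sup_window_density_cvg|].
apply: nearW => n.
exact: le_trans (inf_le_window_density n 0) (window_density_le_sup n 0).
Qed.

(** The error [K] is uniform in [x], so it contributes only [K / n] to the density. *)
Lemma upper_banach_density_le (c K : R) :
  (forall x n, (window_count C x n)%:R <= c * n%:R + K) ->
  upper_banach_density R C <= c.
Proof.
move=> countle; apply/ler_addgt0Pr => e e_gt0.
apply: limr_le; first exact: sup_window_density_cvg.
near=> n.
have n_gt0 : 0 < n%:R :> R by rewrite ltr0n; near: n; exact: nbhs_infty_gt.
have Kn : K / n%:R <= e by near: n; exact: near_infty_div_le.
apply: ge_sup; first exact: window_density_nonempty.
move=> _ [x _ <-]; apply: le_trans (_ : c + K / n%:R <= _); last by rewrite lerD2l.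
by rewrite ler_pdivrMr // mulrDl divfK ?gt_eqF.
Unshelve. all: by end_near. Qed.

Lemma lower_banach_density_ge (c K : R) :
  (forall x n, c * n%:R - K <= (window_count C x n)%:R) ->
  c <= lower_banach_density R C.
Proof.
move=> lecount; apply/ler_addgt0Pr => e e_gt0; rewrite -lerBlDr.
apply: limr_ge; first exact: inf_window_density_cvg.
near=> n.
have n_gt0 : 0 < n%:R :> R by rewrite ltr0n; near: n; exact: nbhs_infty_gt.
have Kn : K / n%:R <= e by near: n; exact: near_infty_div_le.
apply: lb_le_inf; first exact: window_density_nonempty.
move=> _ [x _ <-]; apply: le_trans (_ : _ <= c - K / n%:R) _; first by rewrite lerB.
by rewrite ler_pdivlMr // mulrBl divfK ?gt_eqF.
Unshelve. all: by end_near. Qed.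

End Density.

(** * Bounds on the counts in a window *)

Section WindowBounds.
Variables (C : set int) (W : seq int) (D : nat).
Hypothesis W_bounded : forall w, w \in W -> - D%:Z <= w <= D%:Z.

Lemma window_count_ge x n :
  sumset C [set` W] = setT -> (n <= window_count C x n * size W + 2 * D)%N.
Proof.
move=> CW; rewrite addnC -leq_subLR window_countE.
(* Trimming [D] from each end ensures that the summand from [C] lies in the original window; for
   [n < 2 * D] the trimmed window is empty. *)
rewrite -(size_zwindow (x + D%:Z) (n - 2 * D)).
apply: sum_cover_card_le (zwindow_uniq _ _) _ => z.
have [a Ca [w /= Ww awz]] : sumset C [set` W] z by rewrite CW.
rewrite mem_zwindow => xz; exists a; last by rewrite -awz [a + w]addrC addrK.
have := W_bounded _ Ww.
rewrite mem_filter mem_zwindow mem_set //=; lia.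
Qed.

Lemma minimal_window_count_le x n :
  uniq W -> minimal_additive_complement C [set` W] ->
  (window_count C x n * (2 * size W - 1) <= size W * (n + 2 * D))%N.
Proof.
move=> uW /minimal_complement_unique_sum[u uP].
set A := [seq y <- zwindow x n | y \in C].
have AC a : a \in A -> C a by rewrite mem_filter => /andP[/set_mem].
(* The window enlarged by [D] at each end contains all sums [a + w]. *)
have le : (size A * size W <=
    size A + (size (zwindow (x - D%:Z) (n + 2 * D)) - size A) * size W)%N.
  apply: (@unique_sum_card_le _ u) => //.
  - by rewrite filter_uniq ?zwindow_uniq.
  - exact: zwindow_uniq.
  - move=> a w + /W_bounded; rewrite mem_filter !mem_zwindow => /andP[_]; lia.
  - by move=> a /AC /uP[].
  - by move=> a b w /AC /uP[_ u_uniq] /AC Cb; apply: u_uniq.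
(* This makes the truncated subtraction in [le] exact, so its terms can be rearranged. *)
have Ale : (size A <= n)%N by rewrite -window_countE window_count_le.
move: le; rewrite window_countE -/A size_zwindow mulnBl => le.
have := leq_mul (leq_trans Ale (leq_addr (2 * D) n)) (leqnn (size W)).
rewrite mulnBr; nia.
Qed.

End WindowBounds.

(** * From window counts to density bounds *)

Lemma finite_set_seq (T : choiceType) (W : set T) k :
  (W #= `I_k)%card -> exists s : seq T, [/\ uniq s, size s = k & W = [set` s]].
Proof.
move=> Wk; have fW : finite_set W by exists k.
exists (fset_set W); split; first exact: fset_uniq.
  exact/card_fset_set.
by rewrite fset_setK.
Qed.

Theorem theorem4 (R : realType) (k : nat) (hk : (2 <= k)%N)
    (C W : set int) (hW : (W #= `I_k)%card)
    (hC : minimal_additive_complement C W) :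
  [/\ 1 / k%:R <= lower_banach_density R C,
      lower_banach_density R C <= upper_banach_density R C
    & upper_banach_density R C <= k%:R / (2 * k%:R - 1)].
Proof.
have [s [us sk Ws]] := @finite_set_seq _ _ _ hW; rewrite {}Ws in hC.
have k_gt0 : 0 < k%:R :> R by rewrite ltr0n; lia.
have k2_gt0 : 0 < 2 * k%:R - 1 :> R.
  by have : 2 <= k%:R :> R by [rewrite (ler_nat _ 2)]; lra.
(* The sum of the absolute values serves as a common bound for them. *)
pose D := (\sum_(w <- s) absz w)%N.
have sD w : w \in s -> - D%:Z <= w <= D%:Z.
  move=> ws; have : (absz w <= D)%N by rewrite /D (big_rem w) //= leq_addr.
  lia.
split; last 1 first.
- apply: (@upper_banach_density_le _ _ _ (k%:R / (2 * k%:R - 1) * (2 * D%:R))) => x n.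
  have := @minimal_window_count_le C s D sD x n us hC; rewrite sk -(ler_nat R).
  rewrite !natrM natrD natrM natrB ?natrM; last by lia.
  rewrite -ler_pdivlMr //; move/le_trans; apply.
  by rewrite -mulrDr mulrAC.
- apply: (@lower_banach_density_ge _ _ _ (2 * D%:R / k%:R)) => x n.
  have := @window_count_ge C s D sD x n hC.1; rewrite sk -(ler_nat R) natrD !natrM => le.
  by rewrite mulrAC mul1r -mulrBl ler_pdivrMr // lerBlDr.
- exact: lower_le_upper_banach_density.
Qed.
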